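(* Let $Y\in\mathbb R^{m\times n}$ and let $\mathcal I$ be a set of subsets of $\{1,\ldots,m\}$. The following statements are equivalent: (1) the configuration domain $\mathbb Y_{\mathcal I}$ is regular, i.e. it has non-empty interior in $\mathbb R^m$; (2) there exists a point $\sigma\in\mathbb Y_{\mathcal I}$ such that $P(Y,\sigma)$ is an entirely simple polyhedron.
   Context: For $y\in\mathbb R^m$ let $P(Y,y)=\{x\in\mathbb R^n : Yx\le y\}$ (componentwise inequality). For an index set $I\subseteq\{1,\ldots,m\}$, $Y_I$ and $y_I$ denote the matrix of rows of $Y$ and the vector of entries of $y$ with index in $I$. The face of $P(Y,y)$ associated to $I$ is $\mathcal F_I(y)=\{x\in P(Y,y): Y_I x\ge y_I\}$; in particular $\mathcal F_\varnothing(y)=P(Y,y)$. The polyhedron $P(Y,y)$ is called entirely simple if every $I\subseteq\{1,\ldots,m\}$ with $\mathcal F_I(y)\neq\varnothing$ satisfies $\mathrm{rank}(Y_I)=|I|$ (the empty matrix has rank $0$). The configuration domain of $\mathcal I$ is $\mathbb Y_{\mathcal I}=\{y\in\mathbb R^m : \mathcal F_I(y)\ne\varnothing \text{ for all } I\in\mathcal I\}$. *)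

(* Defs.v *)
(* MathComp-Analysis; the reals are an arbitrary R : realType, R^k is 'cV[R]_k,
   {1,...,m} is 'I_m, and 'cV[R]_m carries the library's (product) topology. *)
From mathcomp Require Import all_boot all_order all_algebra.
From mathcomp Require Import all_classical all_reals all_analysis.
Set Implicit Arguments.
Unset Strict Implicit.
Unset Printing Implicit Defensive.
Import Order.TTheory GRing.Theory Num.Theory.
Import numFieldNormedType.Exports.
Local Open Scope classical_set_scope.
Local Open Scope ring_scope.

Definition cvle (R : realType) (k : nat) (u v : 'cV[R]_k) : Prop :=
  forall i, u i 0 <= v i 0.

(* For I : {set 'I_m} this is Y_I; with p = 1 it also gives the subvector y_I.
   The retained rows are listed by enum_val, in increasing order. *)
Definition rows_in (R : realType) (m p : nat) (I : {set 'I_m})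
    (A : 'M[R]_(m, p)) : 'M[R]_(#|I|, p) :=
  rowsub (fun k : 'I_#|I| => enum_val k) A.

Definition polyhedron (R : realType) (m n : nat) (Y : 'M[R]_(m, n))
    (y : 'cV[R]_m) : set 'cV[R]_n :=
  [set x | cvle (Y *m x) y].

Definition face (R : realType) (m n : nat) (Y : 'M[R]_(m, n))
    (I : {set 'I_m}) (y : 'cV[R]_m) : set 'cV[R]_n :=
  [set x | polyhedron Y y x /\ cvle (rows_in I y) (rows_in I Y *m x)].

(* This depends on the representation (Y, y), not only on the underlying
   set polyhedron Y y. *)
Definition entirely_simple (R : realType) (m n : nat) (Y : 'M[R]_(m, n))
    (y : 'cV[R]_m) : Prop :=
  forall I : {set 'I_m}, face Y I y !=set0 -> \rank (rows_in I Y) = #|I|.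

Definition configuration_domain (R : realType) (m n : nat) (Y : 'M[R]_(m, n))
    (II : {set {set 'I_m}}) : set 'cV[R]_m :=
  [set y | forall I, I \in II -> face Y I y !=set0].

Definition regular_set (T : topologicalType) (A : set T) : Prop :=
  A° !=set0.

(* Main.v *)
(* If y lies outside a finite union of hyperplanes (one for each I with
   dependent rows Y_I, obtained from a linear relation c Y_I = 0, which forces
   c y_I = 0 as soon as F_I(y) is non-empty), then P(Y,y) is entirely simple;
   a non-empty open set is not covered by hyperplanes.  Conversely, if x lies
   in F_I(sigma) and J is the set of all active constraints at x, simplicity
   gives a right inverse B of Y_J, and x + B (y - sigma)_J is a point of F_I(y)
   for all y near sigma. *)
Require Import Defs.
From mathcomp Require Import all_boot all_order all_algebra.
From mathcomp Require Import all_classical all_reals all_analysis.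
Import Order.TTheory GRing.Theory Num.Theory.
Import numFieldNormedType.Exports.
Local Open Scope classical_set_scope.
Local Open Scope ring_scope.

(** Row selection becomes a left factor, so it moves through products by associativity. *)
Lemma rows_inE (R : realType) (m p : nat) (I : {set 'I_m}) (A : 'M[R]_(m, p)) :
  rows_in I A = rows_in I 1%:M *m A.
Proof. by rewrite /rows_in mul_rowsub_mx mul1mx. Qed.

Lemma cvle_rows_in (R : realType) (m : nat) (I : {set 'I_m})
    (u v : 'cV[R]_m) :
  cvle (rows_in I u) (rows_in I v) <-> forall i, i \in I -> u i 0 <= v i 0.
Proof.
split=> [uv i iI | uv k]; last by rewrite !mxE; apply: uv; apply: enum_valP.
by have := uv (enum_rank_in iI i); rewrite !mxE enum_rankK_in.
Qed.

Lemma faceE (R : realType) (m n : nat) (Y : 'M[R]_(m, n)) (I : {set 'I_m})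
    (y : 'cV[R]_m) (x : 'cV[R]_n) :
  face Y I y x <->
  polyhedron Y y x /\ forall i, i \in I -> (Y *m x) i 0 = y i 0.
Proof.
rewrite /face /= -[rows_in I Y *m x]/(rowsub _ Y *m x) mul_rowsub_mx.
rewrite -/(rows_in I (Y *m x)) cvle_rows_in.
split=> -[Px Ix]; split=> // i iI; last by rewrite Ix.
by apply/le_anti; rewrite Px Ix.
Qed.

Lemma mulmx_coord_continuous (R : realType) (k m : nat) (A : 'M[R]_(k, m))
    (i : 'I_k) : continuous (fun y : 'cV[R]_m => (A *m y) i 0).
Proof.
rewrite (_ : (fun y => _) = fun y : 'cV[R]_m => \sum_j A i j * y j 0); last first.
  by apply/funext => y; rewrite mxE.
move=> y; apply: (@cvg_big R^o _ _ _ _ _ _ (nbhs y)) => [|j _].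
  exact: add_continuous.
by apply: cvgM; [exact: cvg_cst | exact: coord_continuous].
Qed.

Lemma open_mulmx_neq0 (R : realType) (m : nat) (c : 'rV[R]_m) :
  open [set y : 'cV[R]_m | (c *m y) 0 0 != 0].
Proof.
apply: (@open_comp _ _ (fun y : 'cV[R]_m => (c *m y) 0 0)
  [set r | r != 0]); last exact: open_neq.
by move=> y _; exact: mulmx_coord_continuous.
Qed.

(** From a point of the hyperplane, a move by [t] along a coordinate [j] with $c_j \ne 0$ gives the
    value $t c_j$; a small nonzero [t] keeps the point in the given open set. *)
Lemma dense_mulmx_neq0 (R : realType) (m : nat) (c : 'rV[R]_m) :
  c != 0 -> dense [set y : 'cV[R]_m | (c *m y) 0 0 != 0].
Proof.
move=> /rV0Pn[j cj] O [y Oy] openO.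
have [cy0 | cy] := eqVneq ((c *m y) 0 0) 0; last by exists y.
pose f t : 'cV[R]_m := y + t *: delta_mx j 0.
have ft : f t @[t --> 0^'] --> y.
  rewrite -[X in _ --> X]addr0 -(scale0r (delta_mx j 0)).
  apply: cvgD; first exact: cvg_cst.
  by apply: cvgZr_tmp; exact: nbhs_dnbhs.
have Oft : \forall t \near 0^', O (f t) by apply: ft; exact: open_nbhs_nbhs.
have nt : \forall t \near (0 : R)^', t != 0 by exact: nbhs_dnbhs_neq.
have [t [Ot t0]] := filter_ex (filterI Oft nt).
exists (f t); split=> //=.
rewrite mulmxDr mxE cy0 add0r -scalemxAr mxE -colE mxE.
by rewrite mulf_neq0.
Qed.

Lemma face_dependent (R : realType) (m n : nat) (Y : 'M[R]_(m, n))
    (I : {set 'I_m}) :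
  \rank (rows_in I Y) <> #|I| ->
  exists2 c : 'rV[R]_m, c != 0 &
    forall y, face Y I y !=set0 -> (c *m y) 0 0 = 0.
Proof.
move=> /eqP; rewrite -/(row_free _) -kermx_eq0 => /matrix0Pn[i [j Kij]].
(* A linear relation among the rows of $Y_I$, with nonzero entry at [j]. *)
pose k := row i (kermx (rows_in I Y)).
have kY : k *m rows_in I Y = 0 by rewrite -row_mul mulmx_ker row0.
have R1 l : (rows_in I 1%:M : 'M[R]_(_, m)) l (enum_val j) = (l == j)%:R.
  by rewrite !mxE (inj_eq enum_val_inj).
(* The witness is [k] extended by zero outside [I], so $c y = k y_I$, and $y_I = Y_I x$ on the
   face. *)
exists (k *m rows_in I 1%:M).
  apply/rV0Pn; exists (enum_val j); rewrite mxE (bigD1 j) //= big1 => [|l lj].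
    by rewrite R1 eqxx mulr1 addr0 mxE.
  by rewrite R1 (negbTE lj) mulr0.
move=> y [x /faceE[_ Ix]].
have -> : k *m rows_in I 1%:M *m y = k *m (rows_in I Y *m x).
  rewrite -mulmxA -rows_inE (rows_inE _ _ _ I Y) -mulmxA -rows_inE; congr (_ *m _).
  by apply/colP => l; rewrite !mxE -Ix ?mxE //; exact: enum_valP.
by rewrite mulmxA kY mul0mx mxE.
Qed.

Lemma open_entirely_simple (R : realType) (m n : nat) (Y : 'M[R]_(m, n))
    (O : set 'cV[R]_m) :
  open O -> O !=set0 -> exists2 y, O y & entirely_simple Y y.
Proof.
move=> openO O0.
suff [y Oy Fy] : exists2 y, O y & forall I, I \in enum {set 'I_m} ->
    face Y I y !=set0 -> \rank (rows_in I Y) = #|I|.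
  by exists y => // I; apply: Fy; rewrite mem_enum.
(* [O] stays general in the induction: each [I] with dependent rows cuts it down to its part off a
   hyperplane, still open and non-empty. *)
elim: (enum _) O openO O0 => [|I s IHs] O openO O0; first by case: O0 => y; exists y.
have [rI | /face_dependent[c c0 cI]] := pselect (\rank (rows_in I Y) = #|I|).
  have [y Oy sy] := IHs O openO O0; exists y => // J.
  by rewrite inE => /orP[/eqP-> // | /sy].
have [|y [Oy cy] sy] := IHs (O `&` [set y | (c *m y) 0 0 != 0]) _
    (dense_mulmx_neq0 _ _ c c0 O O0 openO).
  by apply: openI => //; exact: open_mulmx_neq0.
exists y => // J; rewrite inE => /orP[/eqP-> /cI cy0 | /sy//].
by move: cy; rewrite /= cy0 eqxx.
Qed.

Lemma face_near (R : realType) (m n : nat) (Y : 'M[R]_(m, n))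
    (I : {set 'I_m}) (sigma : 'cV[R]_m) :
  entirely_simple Y sigma -> face Y I sigma !=set0 ->
  \forall y \near sigma, face Y I y !=set0.
Proof.
move=> simp [x /faceE[Px Ix]].
(* Simplicity is applied to [J], which contains [I], so that every constraint outside [J] is strict
   at [x]. *)
pose J := [set i | (Y *m x) i 0 == sigma i 0]%SET.
have /simp/eqP : face Y J sigma !=set0.
  by exists x; apply/faceE; split=> // i; rewrite inE => /eqP.
rewrite -/(row_free _) => /row_freeP[B YB].
(* [D] acts on full vectors by $D v = B v_J$; hence $Y D v$ agrees with $v$ on [J]. *)
pose D := B *m rows_in J 1%:M.
have YD v i : i \in J -> (Y *m D *m v) i 0 = v i 0.
  move=> iJ; have /matrixP/(_ (enum_rank_in iJ i) 0) :
      rows_in J (Y *m D *m v) = rows_in J v.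
    by rewrite rows_inE !mulmxA -rows_inE YB mul1mx -rows_inE.
  by rewrite !mxE enum_rankK_in.
have shiftE y i : (Y *m (x + D *m (y - sigma))) i 0 =
    (Y *m x) i 0 + (Y *m D *m (y - sigma)) i 0.
  by rewrite mulmxDr mulmxA mxE.
have near_lt i : \forall y \near sigma,
    i \notin J -> (Y *m (x + D *m (y - sigma))) i 0 < y i 0.
  have [iJ | iJ] := boolP (i \in J); first by near=> y.
  (* The desired inequality with all terms in [y] moved to one side: a linear functional of [y]
     exceeds a constant. At [sigma] this is the strict slack of constraint [i], and continuity
     extends it nearby. *)
  have lti : ((1%:M - Y *m D) *m sigma) i 0 >
      (Y *m x) i 0 - (Y *m D *m sigma) i 0.
    rewrite mulmxBl mul1mx [ltRHS]mxE [X in _ < _ + X]mxE ltrD2r lt_neqAle Px andbT.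
    by move: iJ; rewrite inE.
  have gti : \forall y \near sigma, ((1%:M - Y *m D) *m y) i 0 >
      (Y *m x) i 0 - (Y *m D *m sigma) i 0.
    exact: cvgr_gt (@mulmx_coord_continuous _ _ _ (1%:M - Y *m D) i sigma) _ lti.
  apply: filterS gti => y + _; rewrite shiftE mulmxBl mul1mx mulmxBr !mxE.
  by rewrite ltrBrDr addrAC addrA.
(* There are finitely many indices [i], so one neighbourhood serves them all. *)
apply: (@filterS _ (nbhs sigma)) (filter_forall _ near_lt) => y ylt.
have Jy i : i \in J -> (Y *m (x + D *m (y - sigma))) i 0 = y i 0.
  move=> iJ; rewrite shiftE YD //; move: iJ; rewrite inE => /eqP->.
  by rewrite !mxE addrCA subrr addr0.
exists (x + D *m (y - sigma)); apply/faceE; split=> [i | i /Ix xi].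
  by have [/Jy-> // | /(ylt i)/ltW] := boolP (i \in J).
by rewrite Jy // inE xi.
Unshelve. all: by end_near. Qed.

Theorem theorem1 (R : realType) (m n : nat) (Y : 'M[R]_(m, n))
    (II : {set {set 'I_m}}) :
  regular_set (configuration_domain Y II) <->
  exists sigma : 'cV[R]_m,
    configuration_domain Y II sigma /\ entirely_simple Y sigma.
Proof.
split=> [int0 | [sigma [dom simp]]].
  (* The open set is the interior of the configuration domain. *)
  have [y /interior_subset dom simp] :=
    open_entirely_simple _ _ _ Y _ (@open_interior _ _) int0.
  by exists y.
exists sigma.
(* Membership in [II] is put inside the neighbourhood statement, so that the finite intersection
   runs over all index sets. *)
have near_face I : \forall y \near sigma, I \in II -> face Y I y !=set0.
  have [/dom/(face_near _ _ _ Y I sigma simp) ev | nI] := boolP (I \in II).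
    by apply: filterS ev.
  by near=> y.
exact: filter_forall near_face.
Unshelve. all: by end_near. Qed.
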